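(* Let $L=(L,\wedge,\vee,1,0)$ be a complete lattice and $X\subseteq L\setminus\{1\}$ a subset such that $L$ is an $X$-top lattice, and equip $X$ with its Zariski-like topology. Then $$\mathrm{Iso}(X)=\mathrm{Min}(X)\cap CSI^X(X).$$
   Context: For a complete lattice $L=(L,\wedge,\vee,1,0)$, $X\subseteq L\setminus\{1\}$ and $a\in L$, put $V(a)=\{x\in X: a\le x\}$ and $D(a)=X\setminus V(a)$. $L$ is an $X$-top lattice iff the family $\{V(a):a\in L\}$ is closed under finite unions (it always contains $X=V(0)$, $\emptyset=V(1)$ and is closed under arbitrary intersections); then the sets $D(a)$, $a\in L$, are the open sets of a topology on $X$, called the Zariski-like topology. $X$ is a poset with the order of $L$, and $\mathrm{Min}(X)$ is the set of its minimal elements. The empty meet is $1$. $\mathrm{Iso}(X)=\{x\in X:\{x\}\text{ is open in }X\}$ is the set of isolated points. $CSI^X(X)$ is the set of completely strongly $X$-irreducible elements of $X$: those $q\in X$ such that for every subset $A\subseteq X$, $\bigwedge_{a\in A}a\le q$ implies $a\le q$ for some $a\in A$. *)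

(* Defs.v *)
From HB Require Import structures.
From mathcomp Require Import all_boot all_order.
From mathcomp Require Import boolp classical_sets functions cardinality.
From mathcomp Require Import topology_structure.

Set Implicit Arguments.
Unset Strict Implicit.
Unset Printing Implicit Defensive.

Import Order.TTheory.
Local Open Scope order_scope.
Local Open Scope classical_set_scope.

(* The bounded lattice structure (meet, join, \top, \bot) is the one of
   MathComp; completeness adds arbitrary meets and joins. The meet (resp. join)
   of the empty set is forced to be \top (resp. \bot). *)
HB.mixin Record isCompleteLattice d L of Order.TBLattice d L := {
  bigmeet : set L -> L ;
  bigjoin : set L -> L ;
  bigmeetP : forall A : set L, infimums A (bigmeet A) ;
  bigjoinP : forall A : set L, supremums A (bigjoin A) }.

#[short(type="completeLatticeType")]
HB.structure Definition CompleteLattice d :=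
  { L of Order.TBLattice d L & isCompleteLattice d L }.

Lemma bigmeet0 (d : Order.disp_t) (L : completeLatticeType d) :
  bigmeet (set0 : set L) = \top.
Proof.
apply/eqP; rewrite -le1x; apply: (bigmeetP (set0 : set L)).2.
by move=> x [].
Qed.

Section XTop.
Context {d : Order.disp_t} {L : completeLatticeType d}.
Implicit Types (X A : set L) (a q x : L).

Definition Vset X a : set L := [set x | X x /\ a <= x].

Definition Dset X a : set L := X `\` Vset X a.

Definition X_top X : Prop :=
  forall F : set (set L), finite_set F -> F `<=` range (Vset X) ->
    range (Vset X) (\bigcup_(U in F) U).

(* The underlying type of [zariski hX] is the subset X itself; X_top is an
   argument because the sets [Dset X a] form a topology only under it. *)
Definition zariski X (hX : X_top X) : Type := {x : L | x \in X}.

Definition zariski_open X (hX : X_top X) : set (set (zariski hX)) :=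
  [set U | exists a, U = sval @^-1` Dset X a].

End XTop.

Section ZariskiTopology.
Context {d : Order.disp_t} {L : completeLatticeType d}.
Variables (X : set L) (hX : X_top X).

HB.instance Definition _ := Choice.copy (zariski hX) {x : L | x \in X}.

Let zariski_openT : zariski_open [set: zariski hX].
Proof.
have [|c _ Vc] := hX (finite_set0 (set L)); first by move=> U [].
exists c; apply/seteqP; split=> // -[x /=]; rewrite inE => Xx _ /=.
by split=> //; rewrite Vc => -[].
Qed.

Let zariski_openI : setI_closed (@zariski_open _ _ _ hX).
Proof.
move=> _ _ [a ->] [b ->].
have [||c _ Vc] := hX (F := [set Vset X a; Vset X b]).
- exact: finite_set2.
- by move=> _ [] ->; [exists a|exists b].
exists c; apply/seteqP; split=> -[x xX] /=.
- move=> [[Xx nxa] [_ nxb]]; split=> //.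
  by rewrite Vc => -[_ [->|->]].
- rewrite /Dset Vc => -[Xx nx].
  by split; split=> // Vx; apply: nx;
    [exists (Vset X a); [left|]|exists (Vset X b); [right|]].
Qed.

Let zariski_open_bigU (I : Type) (f : I -> set (zariski hX)) :
  (forall i, zariski_open (f i)) -> zariski_open (\bigcup_i f i).
Proof.
move=> /choice[a fa]; exists (bigjoin (range a)).
have [ub lub] := bigjoinP (range a).
apply/seteqP; split=> -[x xX] /=.
- move=> [i _]; rewrite fa => -[/= Xx nx]; split=> // -[_ jx].
  by apply: nx; split=> //; apply: le_trans jx; apply: ub; exists i.
- move=> [Xx nx]; apply: contrapT => nU; apply: nx; split=> //.
  apply: lub => _ [i _ <-]; apply: contrapT => nai; apply: nU.
  by exists i => //; rewrite fa; split=> // -[].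
Qed.

HB.instance Definition _ := @isOpenTopological.Build (zariski hX)
  (@zariski_open _ _ _ hX) zariski_openT zariski_openI zariski_open_bigU.

Lemma zariski_openE : (open : set (set (zariski hX))) = @zariski_open _ _ _ hX.
Proof. by []. Qed.

(* As a set of elements of L, so that it can be compared with Min and CSI. *)
Definition Iso : set L :=
  sval @` [set x : zariski hX | open [set x]].

End ZariskiTopology.

Section MinCSI.
Context {d : Order.disp_t} {L : completeLatticeType d}.
Variable X : set L.

Definition Min : set L := [set x | X x /\ forall y, X y -> y <= x -> y = x].

Definition CSI : set L :=
  [set q | X q /\ forall A : set L, A `<=` X -> bigmeet A <= q ->
     exists2 a, A a & a <= q].

End MinCSI.

(* Main.v *)
(* A point x is isolated iff the points of X above some a are exactly those
   other than x; the best candidate for a is the meet of X minus x. *)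
Require Import Defs.
From mathcomp Require Import all_boot all_order.
From mathcomp Require Import boolp classical_sets functions cardinality.
From mathcomp Require Import topology_structure.
Local Open Scope order_scope.
Local Open Scope classical_set_scope.

Import Order.TTheory.

(** By [IsoP], isolation of [x] means that some [a] lies below every point of [X] except [x]. Such
    an [a] cannot lie below anything under [x], which gives minimality and irreducibility.
    Conversely, irreducibility applied to [X] minus [x] would put another point below [x], against
    minimality. *)

Lemma IsoP (d : Order.disp_t) (L : completeLatticeType d) (X : set L)
    (hX : X_top X) (x : L) :
  Iso hX x <-> X x /\ exists a, forall y, X y -> (~ a <= y <-> y = x).
Proof.
split.
- move=> [[z zX] /= oz <-]; have Xz := set_mem zX.
  move: oz; rewrite zariski_openE => -[a za].
  split=> //; exists a => y Xy; have yX : y \in X by rewrite inE.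
  have zy (u : zariski hX) : u = exist _ z zX <-> Dset X a (sval u).
    by move/seteqP: za => [le ge]; split=> [/le|/ge].
  split=> [nay|->].
  + suff /zy/(congr1 sval) : Dset X a (sval (exist _ y yX : zariski hX)) by [].
    by split=> // -[].
  + by have /zy[_ nV] := erefl (exist _ z zX : zariski hX) => az; apply: nV.
- move=> [Xx [a xa]]; have xX : x \in X by rewrite inE.
  exists (exist _ x xX : zariski hX) => //=.
  rewrite zariski_openE; exists a; apply/seteqP; split=> -[y yX] /=.
  + move=> /(congr1 sval) /= ->; split=> // -[_].
    exact: (xa x Xx).2.
  + move=> [Xy nV]; apply: val_inj => /=.
    by apply/(xa y Xy) => ay; apply: nV.
Qed.

Theorem proposition2p16 (d : Order.disp_t) (L : completeLatticeType d)
    (X : set L) (X_proper : X `<=` [set~ \top]) (hX : X_top X) :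
  Iso hX = Min X `&` CSI X.
Proof.
apply/seteqP; split=> x.
- move=> /IsoP[Xx [a xa]]; have nax : ~ a <= x by apply/(xa x Xx).
  split; split=> //.
  + move=> y Xy yx; apply/(xa y Xy) => ay.
    exact/nax/(le_trans ay yx).
  (* If no member of [A] is below [x], then [x] is not in [A], so [a] bounds [A] from below and
     [a <= bigmeet A <= x]. *)
  + move=> A AX Ax; apply: contrapT => nA; apply: nax.
    apply: le_trans Ax; apply: (bigmeetP A).2 => y Ay.
    apply: contrapT => /(xa y (AX y Ay)) yx.
    by apply: nA; exists y; rewrite // yx.
- move=> [[Xx xmin] [_ xCSI]]; apply/IsoP; split=> //.
  (* This meet is below all other points by construction; only its being below [x] has to be
     excluded. *)
  exists (bigmeet (X `\ x)) => y Xy; split=> [ny|->].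
  + apply: contrapT => yx; apply: ny.
    by apply: (bigmeetP (X `\ x)).1; split.
  (* Irreducibility yields [z <= x] with [z] in [X] and [z] distinct from [x]; minimality forces
     [z = x]. *)
  + move=> /xCSI[|z [Xz zx] /(xmin z Xz)//].
    exact: subDsetl.
Qed.
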